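(* Let $(x,y)$ be a pair of doubly commuting isometries in a Baer $*$-ring $R$. There are unique projections $p_{uu},p_{us},p_{su},p_{ss}\in\{x,y\}'$ forming a unity decomposition $$p_{uu}+p_{us}+p_{su}+p_{ss}=1$$ such that: (i) $(p_{uu}x,p_{uu}y)$ is a pair of unitary elements; (ii) $p_{us}x$ is unitary, $p_{us}y$ is a unilateral shift, and $$p_{us}x=\sum_{i=0}^\infty p_{us}x[y^i(1-[y])];$$ (iii) $p_{su}x$ is a unilateral shift, $p_{su}y$ is unitary, and $$p_{su}y=\sum_{i=0}^\infty p_{su}y[x^i(1-[x])];$$ (iv) $(p_{ss}x,p_{ss}y)$ is a pair of unilateral shifts, and $$p_{ss}=\sum_{m,n\ge 0}[p_{ss}x^my^n(1-[x])(1-[y])].$$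
   Context: A Baer $*$-ring is a ring $R$ with unity $1$ and an involution $*$ such that the right annihilator of every subset of $R$ is a principal right ideal generated by a projection (self-adjoint idempotent). Projections are ordered by $p\le q$ iff $pq=p$ and form a complete lattice. For $x\in R$, $[x]$ denotes the left projection of $x$: the smallest projection $e$ with $ex=x$; it satisfies $\{r\in R: rx=0\}=R(1-[x])$. For $T\subset R$, $T'$ is the commutant of $T$. A unity decomposition is a set of pairwise orthogonal projections with sum $1$. For pairwise orthogonal projections $p_i$, $\sum_i p_i$ denotes the supremum of the finite partial sums (equivalently $\sup_i p_i$), and $\sum_i zp_i:=z\sum_i p_i$ for $z\in R$. A pair $(x,y)$ doubly commutes if $x$ commutes with both $y$ and $y^*$. An element $x$ is an isometry if $x^*x=1$ and unitary if $x^*x=xx^*=1$. An isometry $x$ is a unilateral shift if the projections $[x^n(1-[x])]$, $n\ge 0$, are pairwise orthogonal and $\sum_{n=0}^\infty[x^n(1-[x])]=1$. For a projection $p$ commuting with $x$, the compression $px$ is regarded as an element of the corner $pRp$, whose unity is $p$; being unitary or a unilateral shift is understood in that corner (with $p$ in place of $1$). *)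

(* Defs.v *)
From HB Require Import structures.
From mathcomp Require Import all_boot all_order all_algebra.
From mathcomp Require Import boolp classical_sets.

Set Implicit Arguments.
Unset Strict Implicit.
Unset Printing Implicit Defensive.

Import GRing.Theory.
Local Open Scope ring_scope.
Local Open Scope classical_set_scope.

HB.mixin Record PzRing_hasStar R of GRing.PzRing R := {
  star : R -> R;
  starD : {morph star : x y / x + y};
  starM : forall x y, star (x * y) = star y * star x;
  starK : involutive star
}.

(* The zero ring is allowed: corners at the projection 0 must be *-rings. *)
#[short(type="starRingType")]
HB.structure Definition StarRing := { R of GRing.PzRing R & PzRing_hasStar R }.

Definition is_proj (R : starRingType) (p : R) : bool :=
  (p * p == p) && (star p == p).

Definition right_annihilator (R : pzRingType) (S : set R) : set R :=
  [set r | forall s, S s -> s * r = 0].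

Definition principal_right_ideal (R : pzRingType) (e : R) : set R :=
  [set e * t | t in [set: R]].

HB.mixin Record StarRing_isBaer R of StarRing R := {
  baer_ann : forall S : set R, exists2 e : R,
    is_proj e & right_annihilator S = principal_right_ideal e
}.

#[short(type="baerStarRingType")]
HB.structure Definition BaerStarRing := { R of StarRing R & StarRing_isBaer R }.

Record projection (R : starRingType) :=
  Projection { projval : R; projvalP : is_proj projval }.
HB.instance Definition _ (R : starRingType) := [isSub for @projval R].
HB.instance Definition _ (R : starRingType) := [Choice of projection R by <:].

Section StarRingNotions.
Variable R : starRingType.
Implicit Types (x y z p q s : R).

(* The order on projections; on non-projections it is only used for finite sums
   of orthogonal projections, which are projections themselves. *)
Definition proj_le p q : Prop := p * q = p.

Definition is_left_proj x p : Prop :=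
  [/\ is_proj p, p * x = x
    & forall q, is_proj q -> q * x = x -> proj_le p q].

(* The left projection [x]. It exists for every x in a Baer *-ring and in its
   corners, and is then unique; the default value 0 is irrelevant there. *)
Definition lproj x : R := xget 0 (is_left_proj x).

Definition is_proj_sup (A : set R) s : Prop :=
  [/\ is_proj s, forall a, A a -> proj_le a s
    & forall q, is_proj q -> (forall a, A a -> proj_le a q) -> proj_le s q].

(* s = \sum_i p_i for pairwise orthogonal projections p_i; the orthogonality
   is part of the assertion. *)
Definition osum (I : eqType) (p : I -> R) s : Prop :=
  [/\ forall i, is_proj (p i), forall i j, i != j -> p i * p j = 0
    & is_proj_sup [set \sum_(i <- J) p i | J in [set J : seq I | uniq J]] s].

(* t = \sum_i z p_i, that is, t = z \sum_i p_i *)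
Definition osum_mul (I : eqType) z (p : I -> R) (t : R) : Prop :=
  exists2 s, osum p s & t = z * s.

Definition commutant (T : set R) : set R :=
  [set z | forall t, T t -> GRing.comm z t].

Definition doubly_commute x y : Prop := GRing.comm x y /\ GRing.comm x (star y).

Definition star_isometry x : Prop := star x * x = 1.

Definition star_unitary x : Prop := star x * x = 1 /\ x * star x = 1.

Definition unilateral_shift x : Prop :=
  star_isometry x /\ osum (fun n : nat => lproj (x ^+ n * (1 - lproj x))) 1.

Definition unity_decomposition (ps : seq R) : Prop :=
  [/\ all (@is_proj R) ps, pairwise (fun p q => p * q == 0) ps
    & \sum_(p <- ps) p = 1].

End StarRingNotions.

(* The corner pRp as a *-ring with unity p *)
Section Corner.
Variables (R : starRingType) (p : projection R).

Definition in_corner : {pred R} := [pred x | projval p * x * projval p == x].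

Lemma in_corner_zmod : zmod_closed in_corner.
Proof.
split=> [|x y]; rewrite !inE ?mulr0 ?mul0r //.
by move=> /eqP hx /eqP hy; rewrite mulrBr mulrBl hx hy.
Qed.
HB.instance Definition _ := GRing.isZmodClosed.Build R in_corner in_corner_zmod.

Record corner := Corner { cval : R; cvalP : cval \in in_corner }.
HB.instance Definition _ := [isSub for cval].
HB.instance Definition _ := [Choice of corner by <:].
HB.instance Definition _ := [SubChoice_isSubZmodule of corner by <:].

Lemma projMM : projval p * projval p = projval p.
Proof. by have /andP[/eqP] := projvalP p. Qed.

Lemma projS : star (projval p) = projval p.
Proof. by have /andP[_ /eqP] := projvalP p. Qed.

Lemma cval_mull (u : corner) : projval p * cval u = cval u.
Proof. by have /eqP <- := cvalP u; rewrite !mulrA projMM. Qed.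

Lemma cval_mulr (u : corner) : cval u * projval p = cval u.
Proof. by have /eqP <- := cvalP u; rewrite -!mulrA projMM. Qed.

Lemma corner_one_subproof : projval p \in in_corner.
Proof. by rewrite inE !projMM. Qed.

Lemma corner_mul_subproof (u v : corner) : cval u * cval v \in in_corner.
Proof. by rewrite inE mulrA cval_mull -mulrA cval_mulr. Qed.

Lemma corner_star_subproof (u : corner) : star (cval u) \in in_corner.
Proof. by rewrite inE -{1 2}projS -!starM cval_mulr cval_mull. Qed.

Definition corner_one := Corner corner_one_subproof.
Definition corner_mul u v := Corner (corner_mul_subproof u v).
Definition corner_star u := Corner (corner_star_subproof u).

Lemma corner_mulA : associative corner_mul.
Proof. by move=> u v w; apply: val_inj; rewrite /= mulrA. Qed.
Lemma corner_mul1r : left_id corner_one corner_mul.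
Proof. by move=> u; apply: val_inj; rewrite /= cval_mull. Qed.
Lemma corner_mulr1 : right_id corner_one corner_mul.
Proof. by move=> u; apply: val_inj; rewrite /= cval_mulr. Qed.
Lemma corner_mulDl : left_distributive corner_mul +%R.
Proof. by move=> u v w; apply: val_inj; rewrite /= mulrDl. Qed.
Lemma corner_mulDr : right_distributive corner_mul +%R.
Proof. by move=> u v w; apply: val_inj; rewrite /= mulrDr. Qed.
HB.instance Definition _ := GRing.Zmodule_isPzRing.Build corner
  corner_mulA corner_mul1r corner_mulr1 corner_mulDl corner_mulDr.

Lemma corner_starD : {morph corner_star : u v / u + v}.
Proof. by move=> u v; apply: val_inj; rewrite /= starD. Qed.
Lemma corner_starM u v : corner_star (u * v) = corner_star v * corner_star u.
Proof. by apply: val_inj; rewrite /= starM. Qed.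
Lemma corner_starK : involutive corner_star.
Proof. by move=> u; apply: val_inj; rewrite /= starK. Qed.
HB.instance Definition _ := PzRing_hasStar.Build corner
  corner_starD corner_starM corner_starK.

Lemma compress_subproof (x : R) : projval p * x * projval p \in in_corner.
Proof. by rewrite inE !mulrA projMM -!mulrA projMM. Qed.

Definition compress (x : R) : corner := Corner (compress_subproof x).

(* compress x is pxp, which is the element px of pRp when p commutes with x *)
Lemma compressE (x : R) :
  GRing.comm (projval p) x -> cval (compress x) = projval p * x.
Proof. by move=> px; rewrite /= -mulrA -px mulrA projMM. Qed.

End Corner.

Section WoldSlocinski.
Variables (R : starRingType) (x y : R).

Record wold_slocinski (puu pus psu pss : projection R) : Prop := WoldSlocinski {
  ws_commutant : forall p, p \in [:: puu; pus; psu; pss] ->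
    commutant [set x; y] (projval p);
  ws_unity : unity_decomposition
    [:: projval puu; projval pus; projval psu; projval pss];
  ws_uu : star_unitary (compress puu x) /\ star_unitary (compress puu y);
  ws_us : [/\ star_unitary (compress pus x), unilateral_shift (compress pus y)
    & osum_mul (projval pus * x) (fun i : nat => lproj (y ^+ i * (1 - lproj y)))
        (projval pus * x)];
  ws_su : [/\ unilateral_shift (compress psu x), star_unitary (compress psu y)
    & osum_mul (projval psu * y) (fun i : nat => lproj (x ^+ i * (1 - lproj x)))
        (projval psu * y)];
  ws_ss : [/\ unilateral_shift (compress pss x),
      unilateral_shift (compress pss y)
    & osum (fun mn : nat * nat =>
        lproj (projval pss * x ^+ mn.1 * y ^+ mn.2
               * (1 - lproj x) * (1 - lproj y)))
        (projval pss)]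
}.

End WoldSlocinski.

(* Main.v *)
Require Import Defs.
From mathcomp Require Import all_boot all_algebra.
From mathcomp Require Import boolp classical_sets.

(** Each of the two isometries has its own Wold decomposition, and the four
    projections are the products of the two decompositions.

    For an isometry x the left projection of x^n (1 - [x]) is the explicit
    projection e_n = x^n (1 - x (star x)) (star x)^n ([lproj_wandering]), and these are
    pairwise orthogonal. The Baer property yields a projection u such that uR is
    the set of all r with e_n r = 0 for every n ([ann_proj_exists]); then
    1 - u is the sum of the e_n ([osum_ann_proj]), so that u is the unitary part
    of x and 1 - u its shift part. Describing u by annihilators replaces limits
    by algebra: an element that, together with its adjoint, preserves the ideal
    uR commutes with u ([comm_proj_stable]). This shows that u commutes with x
    ([ann_wandering_comm]) and with every element commuting with x and star x.

    For a projection p commuting with x, the position of p relative to u decides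
    the type of the compression: px is unitary in pRp exactly when p <= u
    ([compress_unitaryP]), and it is a unilateral shift there exactly when
    p u = 0 ([compress_shiftP]).

    Let v be the projection obtained in the same way from y. Double commutation
    makes u and v commute with x, with y and with each other, so that uv,
    u(1-v), (1-u)v and (1-u)(1-v) form a unity decomposition with the required
    compressions. The double sum in the doubly shift part is (1-u)(1-v) because
    the projections in it are the products e_m f_n of the projections belonging
    to x and to y, and r is annihilated by all of them exactly when
    (1-u)(1-v) r = 0 ([ann_proj_pair]).

    Conversely, in any such decomposition q_uu + q_us + q_su + q_ss = 1 the two
    criteria give q_uu u = q_uu, q_us u = q_us and q_su u = q_ss u = 0, hence
    u = q_uu + q_us; multiplying this and its complement by v and 1 - v
    recovers all four projections ([wold_slocinski_unique]). *)

Set Implicit Arguments.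
Unset Strict Implicit.
Unset Printing Implicit Defensive.

Import GRing.Theory.
Local Open Scope ring_scope.

(** * Projections, left projections and orthogonal sums *)

Section StarRingTheory.
Variable R : starRingType.
Implicit Types (a b c d p q r s u x y z : R).

Lemma star0 : star (0 : R) = 0.
Proof. by apply: (addrI (star 0)); rewrite -starD !addr0. Qed.

Lemma starN x : star (- x) = - star x.
Proof. by apply: (addrI (star x)); rewrite -starD !subrr star0. Qed.

Lemma starB x y : star (x - y) = star x - star y.
Proof. by rewrite starD starN. Qed.

Lemma star1 : star (1 : R) = 1.
Proof. by rewrite -[LHS]mulr1 -[X in _ * X]starK -starM mulr1 starK. Qed.

Lemma starX x n : star (x ^+ n) = star x ^+ n.
Proof.
elim: n => [|n IHn]; first by rewrite !expr0 star1.
by rewrite exprS starM IHn exprSr.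
Qed.

Lemma is_projP p : is_proj p <-> p * p = p /\ star p = p.
Proof. by split=> [/andP[/eqP ? /eqP ?] | [? ?]] //; apply/andP; split; apply/eqP. Qed.

Lemma is_proj1 : is_proj (1 : R).
Proof. by apply/is_projP; rewrite mulr1 star1. Qed.

Lemma is_proj_compl p : is_proj p -> is_proj (1 - p).
Proof.
move=> /is_projP[pp ps]; apply/is_projP.
by rewrite starB star1 ps mulrBr mulr1 mulrBl mul1r pp subrr subr0.
Qed.

Lemma is_proj_mul p q : is_proj p -> is_proj q -> GRing.comm p q -> is_proj (p * q).
Proof.
move=> /is_projP[pp ps] /is_projP[qq qs] pq; apply/is_projP.
rewrite starM ps qs pq; split=> //.
by rewrite mulrA -(mulrA q) pq mulrA qq -mulrA pp.
Qed.

Lemma mulr_eq0_comm a b c d :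
  GRing.comm b c -> a * c = 0 \/ b * d = 0 -> a * b * (c * d) = 0.
Proof.
move=> bc [ac|bd]; rewrite -mulrA (mulrA b) bc -mulrA.
  by rewrite mulrA ac mul0r.
by rewrite bd !mulr0.
Qed.

Lemma proj_le_star p q :
  is_proj p -> is_proj q -> proj_le p q -> q * p = p.
Proof.
by move=> /is_projP[_ ps] /is_projP[_ qs] pq; rewrite -{1}ps -{1}qs -starM pq.
Qed.

Lemma proj_le_anti p q :
  is_proj p -> is_proj q -> proj_le p q -> proj_le q p -> p = q.
Proof. by move=> pP qP pq qp; rewrite -[LHS](proj_le_star pP qP pq) qp. Qed.

Lemma comm_star z x : star z = z -> GRing.comm z x -> GRing.comm z (star x).
Proof. by move=> zs zx; rewrite /GRing.comm -{1}zs -starM -zx starM zs. Qed.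

Lemma comm_star2 z x : GRing.comm z x -> GRing.comm (star z) (star x).
Proof. by move=> zx; rewrite /GRing.comm -!starM zx. Qed.

Lemma commr1B z x : GRing.comm z x -> GRing.comm z (1 - x).
Proof. by move=> zx; apply: commrB; [exact: commr1|]. Qed.

Lemma comm_defect z x :
  GRing.comm z x -> GRing.comm z (star x) -> GRing.comm z (1 - x * star x).
Proof. by move=> zx zxs; apply/commr1B/commrM. Qed.

Lemma comm_iterate_defect z x n : GRing.comm z x -> GRing.comm z (star x) ->
  GRing.comm z (x ^+ n * (1 - x * star x)).
Proof. by move=> zx zxs; apply: commrM; [exact: commrX | exact: comm_defect]. Qed.

(** After taking adjoints, the condition on star z says that z also preserves
    the orthogonal complement of the range of p. *)
Lemma comm_proj_stable p z : is_proj p ->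
  p * (z * p) = z * p -> p * (star z * p) = star z * p -> GRing.comm z p.
Proof.
move=> /is_projP[_ ps] h1 h2; rewrite /GRing.comm -h1.
by rewrite -[RHS]starK starM ps -h2 !starM starK ps mulrA.
Qed.

(** For a partial isometry the left projection is the range projection; every
    left projection in the theorem is of this form. *)
Lemma lproj_partial_isometry a : a * star a * a = a -> lproj a = a * star a.
Proof.
move=> aaa.
have aP : is_proj (a * star a) by apply/is_projP; rewrite starM starK mulrA aaa.
have aL : is_left_proj a (a * star a).
  split=> // q qP qa; rewrite /proj_le.
  have /is_projP[_ qs] := qP; have /is_projP[_ as_] := aP.
  by rewrite -{1}as_ -{1}qs -starM mulrA qa.
have [lP la lmin] : is_left_proj a (lproj a) by exact: (xgetPex 0 (ex_intro _ _ aL)).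
have [_ _ amin] := aL.
by apply: proj_le_anti => //; [apply: lmin => //; case: aL | apply: amin].
Qed.

Lemma mul_star_commuting a b : GRing.comm a b -> GRing.comm a (star b) ->
  (a * b) * star (a * b) = (a * star a) * (b * star b).
Proof.
move=> ab abs; have asbs := comm_star2 ab.
have asb : GRing.comm (star a) b by rewrite -[b]starK; exact: comm_star2.
have asbb : GRing.comm (star a) (b * star b) by exact: commrM.
by rewrite starM -(mulrA a) (mulrA b) -asbb !mulrA.
Qed.

Lemma partial_isometryM a b : GRing.comm a b -> GRing.comm a (star b) ->
  a * star a * a = a -> b * star b * b = b ->
  (a * b) * star (a * b) * (a * b) = a * b.
Proof.
move=> ab abs aaa bbb; rewrite mul_star_commuting //.
have abb : GRing.comm a (b * star b) by exact: commrM.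
by rewrite -mulrA (mulrA _ a) -abb -(mulrA a (b * star b)) bbb mulrA aaa.
Qed.

(** A projection dominates a finite orthogonal sum as soon as it dominates the
    terms, so the supremum of the partial sums is that of the terms. *)
Lemma osumP (I : eqType) (e : I -> R) s :
  (forall i, is_proj (e i)) -> (forall i j, i != j -> e i * e j = 0) ->
  osum e s <-> [/\ is_proj s, forall i, proj_le (e i) s
    & forall q, is_proj q -> (forall i, proj_le (e i) q) -> proj_le s q].
Proof.
move=> eP eO; split=> [[_ _ [sP sub slub]] | [sP sub slub]].
  split=> // [i|q qP eq].
    by apply: sub; exists [:: i]; rewrite // big_seq1.
  apply: slub => // _ [J _ <-].
  by rewrite /proj_le mulr_suml; apply: eq_bigr => i _; exact: eq.
split=> //; split=> // [_ [J _ <-]|q qP eq].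
  by rewrite /proj_le mulr_suml; apply: eq_bigr => i _; exact: sub.
apply: slub => // i; apply: eq.
by exists [:: i]; rewrite // big_seq1.
Qed.

(** The range projection of x^n (1 - [x]) when x is an isometry. *)
Definition wandering x n : R := x ^+ n * (1 - x * star x) * star x ^+ n.

(** uR is the right annihilator of the family e; r lies in uR iff u r = r. In
    contrast with a supremum of projections, this condition on u speaks of
    arbitrary ring elements r, which is what the commutation proofs need. *)
Definition ann_proj (I : Type) (e : I -> R) u : Prop :=
  is_proj u /\ forall r, (forall i, e i * r = 0) <-> u * r = r.

Lemma ann_proj_mul0 (I : Type) (e : I -> R) u i : ann_proj e u -> e i * u = 0.
Proof. by move=> [/is_projP[uu _] h]; apply: (proj2 (h u)). Qed.

Lemma ann_proj_mulC (I : Type) (e : I -> R) u i : ann_proj e u -> e i * (1 - u) = e i.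
Proof. by move=> eu; rewrite mulrBr mulr1 (ann_proj_mul0 i eu) subr0. Qed.

(** An element commuting with all e_i preserves their annihilator. *)
Lemma ann_proj_comm (I : Type) (e : I -> R) u z : ann_proj e u ->
  (forall i, GRing.comm z (e i)) -> (forall i, GRing.comm (star z) (e i)) ->
  GRing.comm z u.
Proof.
move=> eu ze zse; have [uP h] := eu.
by apply: comm_proj_stable => //; apply/h => i;
  rewrite mulrA -?ze -?zse -mulrA (ann_proj_mul0 i eu) mulr0.
Qed.

(** For a projection q, e_i <= q means that 1 - q annihilates e_i, so q is an
    upper bound iff 1 - q <= u. *)
Lemma osum_ann_proj (I : eqType) (e : I -> R) u :
  (forall i, is_proj (e i)) -> (forall i j, i != j -> e i * e j = 0) ->
  ann_proj e u -> osum e (1 - u).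
Proof.
move=> eP eO eu; have [uP h] := eu; apply/(osumP _ eP eO).
split=> [|i|q qP eq]; [exact: is_proj_compl|exact: ann_proj_mulC|].
have /h uq i : e i * (1 - q) = 0 by rewrite mulrBr mulr1 eq subrr.
apply/eqP; rewrite eq_sym -subr_eq0 -{1}[1 - u]mulr1 -mulrBr.
by rewrite mulrBl mul1r uq ?subrr.
Qed.

(** * The wandering projections of an isometry *)

Section Isometry.
Variable x : R.
Hypothesis hx : star_isometry x.

Lemma isometryX n : star x ^+ n * x ^+ n = 1.
Proof.
elim: n => [|n IHn]; first by rewrite mulr1.
by rewrite exprSr exprS mulrA -(mulrA _ (star x)) hx mulr1.
Qed.

Lemma lproj_isometry : lproj x = x * star x.
Proof. by apply: lproj_partial_isometry; rewrite -mulrA hx mulr1. Qed.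

Lemma defect_proj : is_proj (1 - x * star x).
Proof.
apply: is_proj_compl; apply/is_projP; rewrite starM starK; split=> //.
by rewrite mulrA -(mulrA x) hx mulr1.
Qed.

Lemma defect_mul0 : (1 - x * star x) * x = 0.
Proof. by rewrite mulrBl mul1r -mulrA hx mulr1 subrr. Qed.

Lemma wanderingE n :
  wandering x n = (x ^+ n * (1 - x * star x)) * star (x ^+ n * (1 - x * star x)).
Proof.
have /is_projP[ww ws] := defect_proj.
by rewrite starM ws starX mulrA -(mulrA _ _ (1 - _)) ww.
Qed.

Lemma wandering_partial_isometry n : wandering x n * (x ^+ n * (1 - x * star x)) =
  x ^+ n * (1 - x * star x).
Proof.
have /is_projP[ww ws] := defect_proj.
by rewrite /wandering mulrA -(mulrA _ (star x ^+ n)) isometryX mulr1 -mulrA ww.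
Qed.

Lemma lproj_wandering n : lproj (x ^+ n * (1 - lproj x)) = wandering x n.
Proof.
by rewrite lproj_isometry lproj_partial_isometry -wanderingE //
  wandering_partial_isometry.
Qed.

Lemma wandering_proj n : is_proj (wandering x n).
Proof.
apply/is_projP; split; last by rewrite wanderingE starM starK.
by rewrite {2}wanderingE mulrA wandering_partial_isometry -wanderingE.
Qed.

Lemma wandering_ortho m n : m != n -> wandering x m * wandering x n = 0.
Proof.
wlog lmn : m n / (m < n)%N => [hw mn|_].
  have /orP[|lnm] : (m < n)%N || (n < m)%N by rewrite -neq_ltn.
    by move=> lmn; exact: hw.
  have /is_projP[_ ms] := wandering_proj m; have /is_projP[_ ns] := wandering_proj n.
  by rewrite -ms -ns -starM hw ?star0 // eq_sym.
rewrite -(subnKC lmn) addSn -addnS /wandering exprD !mulrA.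
by rewrite -(mulrA _ (star x ^+ m)) isometryX mulr1 exprS !mulrA -(mulrA _ _ x)
  defect_mul0 mulr0 !mul0r.
Qed.

Lemma wandering_comm z n :
  GRing.comm z x -> GRing.comm z (star x) -> GRing.comm z (wandering x n).
Proof.
by move=> zx zxs; apply: commrM; [exact: comm_iterate_defect | exact: commrX].
Qed.

Lemma osum_wandering u : ann_proj (wandering x) u ->
  osum (fun n : nat => lproj (x ^+ n * (1 - lproj x))) (1 - u).
Proof.
move=> xu; rewrite (_ : (fun _ => _) = wandering x); last first.
  by apply: funext => n; rewrite lproj_wandering.
exact: osum_ann_proj wandering_proj wandering_ortho xu.
Qed.

(** The isometry shifts the family: e_(n+1) x = x e_n, e_0 x = 0 and
    e_n (star x) = (star x) e_(n+1), so x and its adjoint preserve the annihilator. *)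
Lemma ann_wandering_comm u : ann_proj (wandering x) u -> GRing.comm x u.
Proof.
move=> xu; have [uP h] := xu.
apply: comm_proj_stable => //; apply/h => n; rewrite mulrA.
  case: n => [|n].
    by rewrite /wandering !expr0 mul1r mulr1 defect_mul0 mul0r.
  have -> : wandering x n.+1 * x = x * wandering x n.
    by rewrite /wandering exprS exprSr -!mulrA hx mulr1.
  by rewrite -mulrA (ann_proj_mul0 n xu) mulr0.
have -> : wandering x n * star x = star x * wandering x n.+1.
  by rewrite /wandering (exprS x) (exprSr (star x)) !mulrA hx mul1r.
by rewrite -mulrA (ann_proj_mul0 _ xu) mulr0.
Qed.

End Isometry.

End StarRingTheory.

Lemma ann_proj_exists (R : baerStarRingType) (I : Type) (e : I -> R) :
  exists u, ann_proj e u.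
Proof.
have [u uP hu] := baer_ann (range e).
have /is_projP[uu _] := uP.
exists u; split=> // r; split=> [er|ur i].
  have : right_annihilator (range e) r by move=> _ [i _ <-].
  by rewrite hu => -[t _ <-]; rewrite mulrA uu.
have : right_annihilator (range e) r by rewrite hu; exists r.
by apply; exists i.
Qed.

(** * Compressions to a commuting projection *)

Section CornerTheory.
Variables (R : starRingType) (p : projection R) (x : R).
Hypothesis px : GRing.comm (projval p) x.
Local Notation P := (projval p).
Local Notation c := (compress p x).

Lemma cval_compressX n : cval (c ^+ n) = P * x ^+ n.
Proof.
elim: n => [|n IHn]; first by rewrite mulr1.
rewrite !exprS -[cval _]/(cval c * cval (c ^+ n)) IHn compressE //.
by rewrite mulrA -(mulrA P) -px mulrA projMM !mulrA.
Qed.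

Lemma star_compress : star c = compress p (star x).
Proof. by apply: val_inj; rewrite /= !starM projS mulrA. Qed.

End CornerTheory.

Section CornerShift.
Variables (R : starRingType) (p : projection R) (x : R).
Hypothesis px : GRing.comm (projval p) x.
Local Notation P := (projval p).
Local Notation c := (compress p x).

Let pxs : GRing.comm P (star x).
Proof. exact: comm_star (projS p) px. Qed.

Lemma cval_mul_star : cval (c * star c) = P * (x * star x).
Proof.
by rewrite star_compress -[cval _]/(cval c * cval (compress p (star x)))
  !compressE // mulrA -(mulrA P) -px !mulrA projMM.
Qed.

Lemma cval_star_mul : cval (star c * c) = P * (star x * x).
Proof.
by rewrite star_compress -[cval _]/(cval (compress p (star x)) * cval c)
  !compressE // mulrA -(mulrA P) -pxs !mulrA projMM.
Qed.

Lemma cval_wandering n : cval (wandering c n) = P * wandering x n.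
Proof.
rewrite {1}/wandering.
rewrite -[LHS]/(cval (c ^+ n) * (P - cval (c * star c)) * cval (star c ^+ n)).
rewrite cval_mul_star star_compress !cval_compressX // -{2}[P]mulr1 -mulrBr.
have pe k : GRing.comm P (x ^+ k) by exact: commrX.
have pw : GRing.comm P (1 - x * star x) by exact: comm_defect.
have pep : P * x ^+ n * P = P * x ^+ n by rewrite pe -mulrA projMM.
by rewrite /wandering !mulrA pep -(mulrA _ _ P) -pw mulrA pep.
Qed.

Lemma compress_isometry : star_isometry x -> star_isometry c.
Proof. by move=> hx; apply: val_inj; rewrite [LHS]cval_star_mul hx mulr1. Qed.

Lemma corner_is_proj (q : corner p) : is_proj q <-> is_proj (cval q).
Proof.
split=> /is_projP[qq qs]; apply/is_projP; last by split; apply: val_inj.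
by split; [exact: (congr1 (@cval R p) qq) | exact: (congr1 (@cval R p) qs)].
Qed.

Variable u : R.
Hypotheses (hx : star_isometry x) (xu : ann_proj (wandering x) u).

(** The compression is unitary iff p (1 - x (star x)) = 0, that is, iff p annihilates
    e_0; as p commutes with x it then annihilates every e_n. *)
Lemma compress_unitaryP : star_unitary c <-> P * u = P.
Proof.
have [uP h] := xu; have /is_projP[uu us] := uP.
split=> [[_ cc]|pu]; last first.
  split; first exact: compress_isometry.
  apply: val_inj; rewrite [LHS]cval_mul_star -[RHS]/P.
  apply/eqP; rewrite -subr_eq0 -opprB oppr_eq0 -{1}[P]mulr1 -mulrBr -pu -mulrA.
  have /is_projP[_ ws] := defect_proj hx.
  rewrite -us -ws -starM.
  have := ann_proj_mul0 0 xu; rewrite {1}/wandering mul1r mulr1 => ->.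
  by rewrite star0 mulr0.
have pw : P * (1 - x * star x) = 0.
  by rewrite mulrBr mulr1 -cval_mul_star cc subrr.
suff /h up : forall n, wandering x n * P = 0.
  by have := congr1 (@star R) up; rewrite starM us projS.
move=> n; rewrite -(wandering_comm n px pxs) /wandering !mulrA.
by rewrite (commrX n px) -(mulrA _ P) pw mulr0 mul0r.
Qed.

(** The wandering projections of the compression are the p e_n. In one direction
    p (1 - u) is an upper bound of them in the corner, so it is the unit p if
    they sum to p. In the other, an upper bound q in the corner has
    e_n (p - q) = 0 for all n, so p - q = u (p - q) = u p (p - q) = 0. *)
Lemma compress_shiftP : unilateral_shift c <-> P * u = 0.
Proof.
have [uP h] := xu; have /is_projP[uu us] := uP; have hc := compress_isometry hx.
have pu : GRing.comm P u.
  by apply: (ann_proj_comm xu) => n; rewrite ?projS; exact: wandering_comm.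
rewrite /unilateral_shift (_ : (fun _ => _) = wandering c); last first.
  by apply: funext => n; rewrite lproj_wandering.
rewrite (osumP _ (wandering_proj hc) (wandering_ortho hc)).
have pen n : wandering x n * P = P * wandering x n by rewrite wandering_comm.
split=> [[_ [_ _ lub]]|pu0]; last first.
  split=> //; split=> [|n|q qP eq]; [exact: is_proj1|exact: mulr1|].
  suff qE : P - cval q = 0 by apply: val_inj; rewrite /= cval_mull -(subr0 P) -qE subKr.
  have /h <- n : wandering x n * (P - cval q) = 0.
    have := congr1 (@cval _ _) (eq n).
    rewrite -[cval (_ * q)]/(cval (wandering c n) * cval q) cval_wandering.
    by rewrite -pen -mulrA cval_mull mulrBr => ->; rewrite subrr.
  by rewrite -(cval_mull q) -{1}(mulr1 P) -mulrBr mulrA -pu pu0 mul0r.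
have pu' := commr1B pu.
have qP : is_proj (compress p (1 - u)).
  by apply/corner_is_proj; rewrite compressE //; apply: is_proj_mul pu' => //;
    [exact: projvalP | exact: is_proj_compl].
have ub n : proj_le (wandering c n) (compress p (1 - u)).
  apply: val_inj.
  rewrite -[LHS]/(cval (wandering c n) * cval (compress p (1 - u))) compressE //.
  rewrite -[RHS]/(cval (wandering c n)) cval_wandering.
  by rewrite -pen -(mulrA _ P) (mulrA P) projMM pu'
    (mulrA _ (1 - u)) (ann_proj_mulC n xu).
have := congr1 (@cval _ _) (lub _ qP ub).
rewrite -[LHS]/(P * cval (compress p (1 - u))) compressE // mulrA projMM.
rewrite mulrBr mulr1 -[RHS]/P => e.
by rewrite -(subKr P (P * u)) e subrr.
Qed.

End CornerShift.

(** * Doubly commuting isometries *)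

Section DoublyCommuting.
Variables (R : starRingType) (x y : R).
Hypotheses (hx : star_isometry x) (hy : star_isometry y).
Hypothesis hxy : doubly_commute x y.
Variables u v : R.
Hypotheses (xu : ann_proj (wandering x) u) (yv : ann_proj (wandering y) v).

Let cxy : GRing.comm x y := proj1 hxy.
Let cxys : GRing.comm x (star y) := proj2 hxy.
Let cxsy : GRing.comm (star x) y.
Proof. by rewrite /GRing.comm -[RHS]starK starM starK cxys starM starK. Qed.
Let cxsys : GRing.comm (star x) (star y).
Proof. by rewrite /GRing.comm -!starM cxy. Qed.

Lemma comm_x_v : GRing.comm x v.
Proof. by apply: (ann_proj_comm yv) => n; exact: wandering_comm. Qed.

Lemma comm_y_u : GRing.comm y u.
Proof. by apply: (ann_proj_comm xu) => n; apply: wandering_comm; apply: commr_sym. Qed.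

Lemma comm_u_v : GRing.comm u v.
Proof.
have [/is_projP[_ us] _] := xu.
have uy : GRing.comm u y by apply: commr_sym; exact: comm_y_u.
by apply: (ann_proj_comm yv) => n; rewrite ?us; apply: wandering_comm => //;
  apply: comm_star.
Qed.

Lemma wandering_comm2 m n : GRing.comm (wandering x m) (wandering y n).
Proof.
apply: wandering_comm; apply: commr_sym; apply: wandering_comm; exact: commr_sym.
Qed.

(** The annihilator is computed one index at a time: if e_m f_n r = 0 for all m
    and n, then (1 - u) f_n r = f_n (1 - u) r = 0 for all n, whence
    (1 - v) (1 - u) r = 0. *)
Lemma ann_proj_pair :
  ann_proj (fun mn : nat * nat => wandering x mn.1 * wandering y mn.2)
    (1 - (1 - u) * (1 - v)).
Proof.
have [uP hu] := xu; have [vP hv] := yv.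
have cuv : GRing.comm (1 - u) (1 - v).
  by apply/commr1B/commr_sym/commr1B/commr_sym/comm_u_v.
split=> [|r]; first by apply/is_proj_compl/is_proj_mul => //; exact: is_proj_compl.
rewrite mulrBl mul1r; split=> [er|/eqP].
  suff -> : (1 - u) * (1 - v) * r = 0 by rewrite subr0.
  rewrite cuv -mulrA mulrBl mul1r.
  have -> : v * ((1 - u) * r) = (1 - u) * r; last by rewrite subrr.
  apply/hv => n.
  have cun : GRing.comm (wandering y n) (1 - u).
    have /is_projP[_ us] := uP; have uy := commr_sym comm_y_u.
    by apply/commr1B/commr_sym/wandering_comm => //; exact: comm_star.
  rewrite mulrA cun -mulrA mulrBl mul1r.
  have -> : u * (wandering y n * r) = wandering y n * r; last by rewrite subrr.
  by apply/hu => m; rewrite mulrA (er (m, n)).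
rewrite -subr_eq0 addrAC subrr add0r oppr_eq0 => /eqP pr [m n] /=.
have <- : wandering x m * wandering y n * ((1 - u) * (1 - v)) =
          wandering x m * wandering y n.
  rewrite cuv mulrA -(mulrA (wandering x m)) (ann_proj_mulC n yv).
  by rewrite wandering_comm2 -mulrA (ann_proj_mulC m xu).
by rewrite -mulrA pr mulr0.
Qed.

(** The element is the product of the three partial isometries p,
    x^m (1 - x (star x)) and y^n (1 - y (star y)), each commuting with the others and with
    their adjoints; range projections multiply for such products. *)
Lemma lproj_wandering_pair p m n : is_proj p -> GRing.comm p x -> GRing.comm p y ->
  lproj (p * x ^+ m * y ^+ n * (1 - lproj x) * (1 - lproj y)) =
  p * (wandering x m * wandering y n).
Proof.
move=> /is_projP[pp ps] px py; rewrite (lproj_isometry hx) (lproj_isometry hy).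
set d := 1 - x * star x; set d' := 1 - y * star y.
have -> : p * x ^+ m * y ^+ n * d * d' = p * ((x ^+ m * d) * (y ^+ n * d')).
  have yd : GRing.comm (y ^+ n) d.
    by apply: comm_defect; apply: commr_sym; exact: commrX.
  by rewrite -!mulrA (mulrA (y ^+ n)) yd -!mulrA.
have pxs := comm_star ps px; have pys := comm_star ps py.
set a := x ^+ m * d; set b := y ^+ n * d'.
have pa : GRing.comm p a by exact: comm_iterate_defect.
have pb : GRing.comm p b by exact: comm_iterate_defect.
have xb : GRing.comm x b by exact: comm_iterate_defect.
have xsb : GRing.comm (star x) b by exact: comm_iterate_defect.
have bx := commr_sym xb; have bxs := commr_sym xsb.
have ba : GRing.comm b a by exact: comm_iterate_defect.
have bsa : GRing.comm (star b) a.
  apply: comm_iterate_defect; last exact: comm_star2.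
  by rewrite -[x]starK; exact: comm_star2.
have ab := commr_sym ba; have abs := commr_sym bsa.
have aE : a * star a = wandering x m by rewrite wanderingE.
have bE : b * star b = wandering y n by rewrite wanderingE.
have aaa : a * star a * a = a by rewrite aE wandering_partial_isometry.
have bbb : b * star b * b = b by rewrite bE wandering_partial_isometry.
have pab : GRing.comm p (a * b) by exact: commrM.
have pabs := comm_star ps pab.
rewrite lproj_partial_isometry; last first.
  by apply: partial_isometryM; rewrite ?ps ?pp //; exact: partial_isometryM.
by rewrite (mul_star_commuting pab pabs) (mul_star_commuting ab abs) aE bE ps pp.
Qed.

End DoublyCommuting.

(** * Uniqueness and existence of the decomposition *)

Section Uniqueness.
Variables (R : starRingType) (x y : R).
Hypotheses (hx : star_isometry x) (hy : star_isometry y).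
Variables u v : R.
Hypotheses (xu : ann_proj (wandering x) u) (yv : ann_proj (wandering y) v).

(** The types of the compressions decide whether q u and q v are q or 0, for each
    projection q of the decomposition; since the four sum to 1, this gives
    u = q_uu + q_us and 1 - u = q_su + q_ss, which v then splits further. *)
Lemma wold_slocinski_unique (quu qus qsu qss : projection R) :
  wold_slocinski x y quu qus qsu qss ->
  [/\ projval quu = u * v, projval qus = u * (1 - v),
      projval qsu = (1 - u) * v & projval qss = (1 - u) * (1 - v)].
Proof.
case=> cq [_ _ sumq] [uxx uyy] [usx usy _] [sux suy _] [ssx ssy _].
have cqx q : q \in [:: quu; qus; qsu; qss] -> GRing.comm (projval q) x.
  by move=> /cq; apply; left.
have cqy q : q \in [:: quu; qus; qsu; qss] -> GRing.comm (projval q) y.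
  by move=> /cq; apply; right.
have uu := mem_head quu [:: qus; qsu; qss].
have [us su ss] : [/\ qus \in [:: quu; qus; qsu; qss], qsu \in [:: quu; qus; qsu; qss]
    & qss \in [:: quu; qus; qsu; qss]] by rewrite !inE !eqxx !orbT.
move: uxx usx => /(compress_unitaryP (cqx _ uu) hx xu) uu_u.
move=> /(compress_unitaryP (cqx _ us) hx xu) us_u.
move: uyy suy => /(compress_unitaryP (cqy _ uu) hy yv) uu_v.
move=> /(compress_unitaryP (cqy _ su) hy yv) su_v.
move: sux ssx => /(compress_shiftP (cqx _ su) hx xu) su_u.
move=> /(compress_shiftP (cqx _ ss) hx xu) ss_u.
move: usy ssy => /(compress_shiftP (cqy _ us) hy yv) us_v.
move=> /(compress_shiftP (cqy _ ss) hy yv) ss_v.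
have sum1 : projval quu + projval qus + (projval qsu + projval qss) = 1.
  by rewrite -sumq !big_cons big_nil addr0 !addrA.
have uE : u = projval quu + projval qus.
  by rewrite -[u]mul1r -sum1 !mulrDl uu_u us_u su_u ss_u !addr0.
have uCE : 1 - u = projval qsu + projval qss.
  by rewrite uE -sum1 addrAC subrr add0r.
have uvE : u * v = projval quu by rewrite uE mulrDl uu_v us_v addr0.
have uCvE : (1 - u) * v = projval qsu by rewrite uCE mulrDl su_v ss_v addr0.
split=> //.
  by rewrite mulrBr mulr1 uvE uE addrAC subrr add0r.
by rewrite mulrBr mulr1 uCvE uCE addrAC subrr add0r.
Qed.

End Uniqueness.

Unset Implicit Arguments.

Theorem theorem4p4 (R : baerStarRingType) (x y : R)
    (hx : star_isometry x) (hy : star_isometry y) (hxy : doubly_commute x y) :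
  exists puu pus psu pss : projection R,
    wold_slocinski x y puu pus psu pss /\
    (forall quu qus qsu qss : projection R,
       wold_slocinski x y quu qus qsu qss ->
       [/\ quu = puu, qus = pus, qsu = psu & qss = pss]).
Proof.
have [u xu] := ann_proj_exists (wandering x).
have [v yv] := ann_proj_exists (wandering y).
have [uP _] := xu; have [vP _] := yv.
have /is_projP[uu _] := uP; have /is_projP[vv _] := vP.
have cxu := ann_wandering_comm hx xu; have cyv := ann_wandering_comm hy yv.
have cxv := comm_x_v hxy yv; have cyu := comm_y_u hxy xu.
have cuv := comm_u_v hxy xu yv.
have cvu := commr_sym cuv.
have uC : GRing.comm u (1 - v) by exact: commr1B.
have Cv : GRing.comm (1 - u) v by apply: commr_sym; exact: commr1B.
have CC : GRing.comm (1 - u) (1 - v) by exact: commr1B.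
have uCP := is_proj_compl uP; have vCP := is_proj_compl vP.
have uu0 : (1 - u) * u = 0 by rewrite mulrBl mul1r uu subrr.
have u0u : u * (1 - u) = 0 by rewrite mulrBr mulr1 uu subrr.
have vv0 : (1 - v) * v = 0 by rewrite mulrBl mul1r vv subrr.
have v0v : v * (1 - v) = 0 by rewrite mulrBr mulr1 vv subrr.
pose puu := Projection (is_proj_mul uP vP cuv).
pose pus := Projection (is_proj_mul uP vCP uC).
pose psu := Projection (is_proj_mul uCP vP Cv).
pose pss := Projection (is_proj_mul uCP vCP CC).
exists puu, pus, psu, pss; split; last first.
  move=> quu qus qsu qss /(wold_slocinski_unique hx hy xu yv)[e1 e2 e3 e4].
  by split; apply: val_inj.
have cpx p : p \in [:: puu; pus; psu; pss] -> GRing.comm (projval p) x.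
  by rewrite !inE => /or4P[] /eqP -> /=; apply: commr_sym; apply: commrM => //;
    exact: commr1B.
have cpy p : p \in [:: puu; pus; psu; pss] -> GRing.comm (projval p) y.
  by rewrite !inE => /or4P[] /eqP -> /=; apply: commr_sym; apply: commrM => //;
    exact: commr1B.
have muu := mem_head puu [:: pus; psu; pss].
have [mus msu mss] : [/\ pus \in [:: puu; pus; psu; pss], psu \in [:: puu; pus; psu; pss]
    & pss \in [:: puu; pus; psu; pss]] by rewrite !inE !eqxx !orbT.
split.
- by move=> p hp t [->|->]; [exact: cpx | exact: cpy].
- split; first by rewrite /= !(projvalP puu, projvalP pus, projvalP psu, projvalP pss).
    have Cu : GRing.comm v (1 - u) by exact: commr_sym.
    have Cu' : GRing.comm (1 - v) (1 - u) by exact: commr_sym.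
    have Cu1 : GRing.comm (1 - v) u by exact: commr_sym.
    by rewrite /= !mulr_eq0_comm ?eqxx; auto.
  have addC z : z + (1 - z) = 1 :> R by rewrite addrC subrK.
  by rewrite !big_cons big_nil addr0 /= addrA -!mulrDr !addC !mulr1 addC.
- split.
    by apply/(compress_unitaryP (cpx _ muu) hx xu); rewrite /= cuv -mulrA uu.
  by apply/(compress_unitaryP (cpy _ muu) hy yv); rewrite /= -mulrA vv.
- split.
  + by apply/(compress_unitaryP (cpx _ mus) hx xu); rewrite /= uC -mulrA uu.
  + by apply/(compress_shiftP (cpy _ mus) hy yv); rewrite /= -mulrA vv0 mulr0.
  + exists (1 - v); first exact: osum_wandering.
    have /is_projP[idem _] := vCP.
    have cxvC := commr1B cxv.
    by rewrite /= -(mulrA _ x) cxvC mulrA -(mulrA u (1 - v) (1 - v)) idem.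
- split.
  + by apply/(compress_shiftP (cpx _ msu) hx xu); rewrite /= Cv -mulrA uu0 mulr0.
  + by apply/(compress_unitaryP (cpy _ msu) hy yv); rewrite /= -mulrA vv.
  + exists (1 - u); first exact: osum_wandering.
    have /is_projP[idem _] := uCP.
    have cyuC := commr1B cyu.
    by rewrite /= -(mulrA _ y) cyuC Cv mulrA -(mulrA v (1 - u) (1 - u)) idem.
- split.
  + by apply/(compress_shiftP (cpx _ mss) hx xu); rewrite /= CC -mulrA uu0 mulr0.
  + by apply/(compress_shiftP (cpy _ mss) hy yv); rewrite /= -mulrA vv0 mulr0.
  + have -> : (fun mn : nat * nat => lproj (projval pss * x ^+ mn.1 * y ^+ mn.2
        * (1 - lproj x) * (1 - lproj y))) =
        (fun mn => wandering x mn.1 * wandering y mn.2).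
      apply: funext => -[m n] /=.
      rewrite (lproj_wandering_pair hx hy hxy _ _ (projvalP pss)
        (cpx _ mss) (cpy _ mss)).
      have EP := is_proj_mul (wandering_proj hx m) (wandering_proj hy n)
        (wandering_comm2 hxy m n).
      apply: (proj_le_star EP (projvalP pss)).
      by have := ann_proj_mulC (m, n) (ann_proj_pair hxy xu yv); rewrite subKr.
    have -> : projval pss = 1 - (1 - (1 - u) * (1 - v)) by rewrite subKr.
    apply: (osum_ann_proj _ _ (ann_proj_pair hxy xu yv)).
      move=> mn; apply: is_proj_mul (wandering_comm2 hxy _ _); exact: wandering_proj.
    move=> [m n] [m' n']; rewrite xpair_eqE negb_and => ne /=.
    apply: mulr_eq0_comm; first by apply: commr_sym; exact: wandering_comm2.
    by case/orP: ne => ne; [left|right]; exact: wandering_ortho.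
Qed.
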